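(* For every positive integer $n$ there exists a bijection $\Phi:\mathfrak{S}_n\to\mathfrak{S}_n$ such that for all $\pi\in\mathfrak{S}_n$, $$\bigl(\mathrm{Asc}_2(\Phi(\pi)),\ \mathrm{Des}(\Phi(\pi)),\ \mathrm{Suc}(\Phi(\pi))\bigr)=\bigl(\widehat{\mathrm{Exc}}(\pi),\ \mathrm{Drop}(\pi),\ \widehat{\mathrm{Fix}}(\pi)\bigr).$$
   Context: $[n]=\{1,\dots,n\}$, $[2,n]=\{2,\dots,n\}$, and $\mathfrak{S}_n$ is the set of permutations $\pi=\pi_1\pi_2\cdots\pi_n$ of $[n]$. For $\pi\in\mathfrak{S}_n$ define the following sets of values (not positions): - $\mathrm{Asc}_2(\pi)=\{\pi_{i+1}: \pi_{i+1}\ge \pi_i+2,\ i\in[n-1]\}$, - $\mathrm{Des}(\pi)=\{\pi_{i+1}: \pi_i>\pi_{i+1},\ i\in[n-1]\}$, - $\mathrm{Suc}(\pi)=\{\pi_{i+1}: \pi_{i+1}=\pi_i+1,\ i\in[n-1]\}$, - $\mathrm{Drop}(\pi)=\{\pi_i: \pi_i<i,\ i\in[2,n]\}$, - $\widehat{\mathrm{Exc}}(\pi)=\{\pi_i: \pi_i>i,\ i\in[2,n]\}$, - $\widehat{\mathrm{Fix}}(\pi)=\{\pi_i: \pi_i=i,\ i\in[2,n]\}$. *)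

(* Defs.v *)
From mathcomp Require Import all_boot all_fingroup.

Set Implicit Arguments.
Unset Strict Implicit.
Unset Printing Implicit Defensive.

(* A permutation of [n] = {1, ..., n} is an element of 'S_n,
   i.e. a permutation of 'I_n = {0, ..., n-1}: positions and values are both
   shifted by one, so that i : 'I_n stands for i + 1.  All conditions below
   compare positions and values only through differences, so they are unaffected
   by the shift, except that "i in [2, n]" reads 0 < i.
   All six statistics are sets of values of pi.  In the first three, j is the
   position following i. *)

Section Statistics.

Variable n : nat.
Implicit Type pi : 'S_n.

Definition Asc2 pi : {set 'I_n} :=
  [set pi j | j : 'I_n & [exists i : 'I_n, (j == i.+1 :> nat) && (pi i + 2 <= pi j)]].

Definition Des pi : {set 'I_n} :=
  [set pi j | j : 'I_n & [exists i : 'I_n, (j == i.+1 :> nat) && (pi j < pi i)]].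

Definition Suc pi : {set 'I_n} :=
  [set pi j | j : 'I_n &
     [exists i : 'I_n, (j == i.+1 :> nat) && (pi j == pi i + 1 :> nat)]].

Definition Drop pi : {set 'I_n} := [set pi i | i : 'I_n & (0 < i) && (pi i < i)].

Definition Exc_hat pi : {set 'I_n} := [set pi i | i : 'I_n & (0 < i) && (i < pi i)].

Definition Fix_hat pi : {set 'I_n} := [set pi i | i : 'I_n & (0 < i) && (pi i == i)].

End Statistics.

(* Main.v *)
Require Import Defs.
From mathcomp Require Import all_boot all_fingroup.
From mathcomp Require Import zify.

Set Implicit Arguments.
Unset Strict Implicit.
Unset Printing Implicit Defensive.

(** The bijection is built by induction on [n], inserting the largest value on
both sides.

Read each value [v] of a word against the letter [a] preceding it, and each
value [v] of a permutation against its position [a].  Then [v] lies in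
Suc, Asc2 or Des according to whether [a.+1] is equal to, smaller or larger
than [v], and in Fix, Exc or Drop according to whether [a] is.  On both sides
exactly one value escapes the classification: the one in position 0.

Let [M] be a new largest value.  In a permutation, [M] is inserted either as a
fixed point, which changes no other class, or in a cycle just before a value
[x], taking over the position of [x] ([cycle_ins]): this makes [x] a drop and
makes [M] an excedance, unless [x] stood first, in which case [M] now does.
In a word, inserting [M] just before a letter [x] makes [x] a descent bottom
and [M] an ascent of size at least 2, with the same proviso on the first
place, so inserting before [x] is the natural counterpart of inserting in the
cycle before [x], and inserting at the end that of a fixed point
([word_ins]).  This fails for two places only.  Let [m] be the old largest
letter.  Right after [m], the letter [M] is a succession; and there no other
class changes, since the letter following [m], if any, is a descent bottom
already.  At the end, if [m] is not last, [M] is an ascent of size at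
least 2, and again no other class changes.  So exchanging these two places
([slot]) repairs the correspondence: a fixed [M] goes right after [m], and [M]
inserted in the cycle before the successor of [m] goes to the end
([slot_cycle_old], [slot_max_exc], [slot_max_fixed]). *)

Import GroupScope.

(** * Classes of values *)

(** The relations between [a] and [b] that depend only on their relative order;
treating all of them at once handles the three statistics uniformly, and the
always true one records which value comes first. *)
Definition by_order (gt eq lt : bool) (a b : nat) : bool :=
  if b < a then gt else if a == b then eq else lt.

(** The successor shift [(w i).+1] aligns words with permutations: a succession
becomes an equality, as for a fixed point. *)
Definition word_stat n (R : rel nat) (w : 'S_n) : {set 'I_n} :=
  [set v | [exists i : 'I_n, (w^-1 v == i.+1 :> nat) && R (w i).+1 v]].

Definition perm_stat n (R : rel nat) (s : 'S_n) : {set 'I_n} :=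
  [set v | (0 < s^-1 v) && R (s^-1 v) v].

Lemma in_word_statS n R (w : 'S_n) (v i : 'I_n) :
  w^-1 v = i.+1 :> nat -> (v \in word_stat R w) = R (w i).+1 v.
Proof.
move=> Ei; rewrite inE; apply/existsP/idP => [[j /andP[]]|HR].
  by rewrite Ei eqSS => /eqP/val_inj <-.
by exists i; rewrite Ei eqxx.
Qed.

Lemma in_word_stat0 n R (w : 'S_n) (v : 'I_n) :
  w^-1 v = 0 :> nat -> (v \in word_stat R w) = false.
Proof. by move=> E0; rewrite inE; apply/existsP => -[j]; rewrite E0. Qed.

Lemma in_word_stat_true n (w : 'S_n) (v : 'I_n) :
  (v \in word_stat (by_order true true true) w) = (0 < w^-1 v).
Proof.
case Ei: (nat_of_ord (w^-1 v)) => [|i]; first by rewrite in_word_stat0.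
have lt_in : i < n by have := ltn_ord (w^-1 v); lia.
by rewrite (@in_word_statS _ _ _ _ (Ordinal lt_in)) // /by_order !if_same.
Qed.

Lemma in_perm_stat_true n (s : 'S_n) (v : 'I_n) :
  (v \in perm_stat (by_order true true true) s) = (0 < s^-1 v).
Proof. by rewrite inE /by_order !if_same andbT. Qed.

(** * Inserting the largest value *)

Definition word_ins n (w : 'S_n) (i : 'I_n.+1) : 'S_n.+1 := lift_perm i ord_max w.

(** Only the letter right after the inserted maximum gets a new predecessor. *)
Lemma word_ins_old n R (w : 'S_n) i (y : 'I_n) :
  (lift ord_max y \in word_stat R (word_ins w i)) =
  if w^-1 y == i :> nat then R n.+1 y else y \in word_stat R w.
Proof.
have EV : (word_ins w i)^-1 (lift ord_max y) = lift i (w^-1 y).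
  by rewrite /word_ins lift_permV lift_perm_lift.
have ltk := ltn_ord (w^-1 y).
have Ey : bump n y = y by rewrite /bump leqNgt ltn_ord.
case: eqP => Eki.
  rewrite (@in_word_statS _ _ _ _ i) /=; last by rewrite EV /= /bump; lia.
  by rewrite /word_ins lift_perm_id /= Ey.
case Ek: (nat_of_ord (w^-1 y)) => [|k].
  rewrite in_word_stat0; last by rewrite EV /= /bump; lia.
  by rewrite in_word_stat0.
have ltkn : k < n by lia.
rewrite (@in_word_statS _ R w y (Ordinal ltkn)) //.
rewrite (@in_word_statS _ _ _ _ (lift i (Ordinal ltkn))) /=; last first.
  by rewrite EV /= /bump; lia.
rewrite /word_ins lift_perm_lift /= Ey.
by rewrite [bump n _]/bump leqNgt ltn_ord.
Qed.

Lemma word_ins_max_first n R (w : 'S_n) (i : 'I_n.+1) :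
  i = 0 :> nat -> (ord_max \in word_stat R (word_ins w i)) = false.
Proof.
by move=> Ei; rewrite in_word_stat0 // /word_ins lift_permV lift_perm_id.
Qed.

Lemma word_ins_max_after n R (w : 'S_n) (i : 'I_n.+1) (j : 'I_n) :
  i = j.+1 :> nat -> (ord_max \in word_stat R (word_ins w i)) = R (w j).+1 n.
Proof.
move=> Ei; rewrite (@in_word_statS _ _ _ _ (lift i j)) /=.
  rewrite /word_ins lift_perm_lift /= /bump.
  by rewrite leqNgt ltn_ord.
by rewrite /word_ins lift_permV lift_perm_id Ei /= /bump; lia.
Qed.

(** Inserts the new maximum in the cycle of [x], between the former preimage of
[x] and [x]; when [x] is the new maximum itself, it becomes a fixed point. *)
Definition cycle_ins n (s : 'S_n) (x : 'I_n.+1) : 'S_n.+1 :=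
  lift_perm ord_max ord_max s * tperm ord_max x.

Lemma cycle_insV n (s : 'S_n) x v :
  (cycle_ins s x)^-1 v = lift_perm ord_max ord_max s^-1 (tperm ord_max x v).
Proof. by rewrite /cycle_ins invMg tpermV lift_permV permM. Qed.

(** Only [x] changes position: it moves to the last one, which exceeds every
old value. *)
Lemma cycle_ins_old n gt eq lt (s : 'S_n) x (y : 'I_n) :
  (lift ord_max y \in perm_stat (by_order gt eq lt) (cycle_ins s x)) =
  if x == lift ord_max y then gt else y \in perm_stat (by_order gt eq lt) s.
Proof.
have Ey : lift ord_max y = y :> nat by rewrite lift_max.
rewrite !inE cycle_insV; case: eqP => [->|/eqP ne].
  by rewrite tpermR lift_perm_id /by_order Ey /= ltn_ord; have := ltn_ord y; lia.
by rewrite tpermD ?neq_lift // lift_perm_lift !lift_max.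
Qed.

Lemma cycle_ins_fixed n gt eq lt (s : 'S_n.+1) :
  (ord_max \in perm_stat (by_order gt eq lt) (cycle_ins s ord_max)) = eq.
Proof.
by rewrite inE cycle_insV tpermL lift_perm_id /by_order /= ltnn eqxx.
Qed.

(** The new maximum takes over the position of [y], which is smaller than it;
position 0 does not count. *)
Lemma cycle_ins_exc n gt eq lt (s : 'S_n) (y : 'I_n) :
  (ord_max \in perm_stat (by_order gt eq lt) (cycle_ins s (lift ord_max y))) =
  (0 < s^-1 y) && lt.
Proof.
rewrite inE cycle_insV tpermL lift_perm_lift /by_order !lift_max /=.
have := ltn_ord (s^-1 y); do 2?case: ifP; lia.
Qed.

Lemma cycle_ins_inj n : injective (fun sx : 'S_n * 'I_n.+1 => cycle_ins sx.1 sx.2).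
Proof.
move=> [s x] [t y] /= E.
have Exy : x = y.
  have := congr1 (fun u : 'S_n.+1 => u ord_max) E.
  by rewrite /cycle_ins !permM !lift_perm_id !tpermL.
rewrite Exy in E *; move/mulIg: E => E; congr (_, _).
apply/permP => i; have := congr1 (fun u : 'S_n.+1 => u (lift ord_max i)) E.
by rewrite !lift_perm_lift => /lift_inj.
Qed.

Lemma word_ins_inj n : injective (fun wi : 'S_n * 'I_n.+1 => word_ins wi.1 wi.2).
Proof.
move=> [s x] [t y] /= E.
have Exy : x = y.
  have := congr1 (fun u : 'S_n.+1 => u^-1 ord_max) E.
  by rewrite /word_ins !lift_permV !lift_perm_id.
rewrite Exy in E *; congr (_, _).
apply/permP => i; have := congr1 (fun u : 'S_n.+1 => u (lift y i)) E.
by rewrite !lift_perm_lift => /lift_inj.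
Qed.

Lemma cycle_ins_bij n : bijective (fun sx : 'S_n * 'I_n.+1 => cycle_ins sx.1 sx.2).
Proof.
apply: inj_card_bij; first exact: cycle_ins_inj.
by rewrite card_prod !card_Sn card_ord factS mulnC.
Qed.

(** * Matching the two insertions *)

Definition after_top n (w : 'S_n.+1) : 'I_n.+2 := lift ord0 (w^-1 ord_max).

(** Sends [x] to the place of the word at which the new maximum is inserted when
it precedes [x] in its cycle: in front of the letter [x] (at the end if [x] is
the new maximum), except that the end and the place after the old largest
letter are exchanged. *)
Definition slot n (w : 'S_n.+1) : 'S_n.+2 :=
  lift_perm ord_max ord_max w^-1 * tperm ord_max (after_top w).

Lemma slot_max n (w : 'S_n.+1) : slot w ord_max = after_top w.
Proof. by rewrite /slot permM lift_perm_id tpermL. Qed.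

(** The letter following the largest one is a descent bottom, so putting a still
larger letter in front of it does not change its class. *)
Lemma in_word_stat_after_top n gt eq lt (w : 'S_n.+1) (y : 'I_n.+1) :
  w^-1 y = after_top w :> nat -> (y \in word_stat (by_order gt eq lt) w) = gt.
Proof.
move=> Ey; rewrite (@in_word_statS _ _ _ _ (w^-1 ord_max)) //.
by rewrite permKV /by_order /= ltn_ord.
Qed.

(** The same rule as in [cycle_ins_old].  The exchange made by [slot] is
invisible here: it matters only for the letter following the largest one, whose
class is that of a descent bottom whether or not a new letter precedes it. *)
Lemma slot_cycle_old n gt eq lt (w : 'S_n.+1) x (y : 'I_n.+1) :
  (lift ord_max y \in word_stat (by_order gt eq lt) (word_ins w (slot w x))) =
  if x == lift ord_max y then gt else y \in word_stat (by_order gt eq lt) w.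
Proof.
rewrite word_ins_old.
have -> : by_order gt eq lt n.+2 y = gt.
  by rewrite /by_order ifT //; have := ltn_ord y; lia.
have [Ey|ney] := eqVneq (nat_of_ord (w^-1 y)) (after_top w).
  by rewrite (in_word_stat_after_top _ _ _ Ey) !if_same.
congr (if _ then _ else _).
have -> : (w^-1 y == slot w x :> nat) = (lift ord_max (w^-1 y) == slot w x).
  by rewrite -val_eqE /= /bump leqNgt ltn_ord.
rewrite -(inj_eq (@perm_inj _ (slot w))).
rewrite /slot !permM lift_perm_lift.
rewrite [tperm _ _ (lift _ _)]tpermD ?neq_lift //.
by rewrite eq_sym -val_eqE /= [bump n.+1 _]/bump leqNgt ltn_ord.
Qed.

(** The same rule as in [cycle_ins_exc].  Thanks to the exchange made by [slot],
the new maximum never follows the old one here, so it exceeds its predecessor by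
at least 2. *)
Lemma slot_max_exc n gt eq lt (w : 'S_n.+1) (y : 'I_n.+1) :
  (ord_max \in word_stat (by_order gt eq lt) (word_ins w (slot w (lift ord_max y)))) =
  (0 < w^-1 y) && lt.
Proof.
have not_top (j : 'I_n.+1) : j != w^-1 ord_max -> by_order gt eq lt (w j).+1 n.+1 = lt.
  move=> ne; have ne2 : w j != ord_max.
    by apply: contra ne => /eqP <-; rewrite permK.
  have := ltn_ord (w j); move: ne2; rewrite -val_eqE /by_order /=.
  by do 2?case: ifP; lia.
rewrite /slot permM lift_perm_lift.
have [Ey|ney] := eqVneq (lift ord_max (w^-1 y)) (after_top w).
  have Evy := congr1 val Ey; rewrite /= [bump n.+1 _]/bump leqNgt ltn_ord /= in Evy.
  (* The letter [y] follows the old maximum, which therefore is not the last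
     letter; the new one goes to the end. *)
  rewrite Ey tpermR (@word_ins_max_after _ _ _ _ (ord_max)) // not_top; last first.
    have := ltn_ord (w^-1 y).
    by rewrite -val_eqE /=; move: Evy; rewrite /bump /=; lia.
  by move: Evy; rewrite /bump /=; case: (nat_of_ord (w^-1 y)).
rewrite tpermD ?neq_lift 1?eq_sym //.
case Ek: (nat_of_ord (w^-1 y)) => [|k].
  by rewrite word_ins_max_first ?lift_max.
have ltk : k < n.+1 by have := ltn_ord (w^-1 y); lia.
rewrite (@word_ins_max_after _ _ _ _ (Ordinal ltk)) ?lift_max // not_top //.
apply: contra ney; rewrite -!val_eqE /= [bump n.+1 _]/bump leqNgt ltn_ord.
by rewrite /bump /=; lia.
Qed.

Lemma slot_max_fixed n gt eq lt (w : 'S_n.+1) :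
  (ord_max \in word_stat (by_order gt eq lt) (word_ins w (slot w ord_max))) = eq.
Proof.
rewrite slot_max (@word_ins_max_after _ _ _ _ (w^-1 ord_max)) //.
by rewrite permKV /by_order /= ltnn eqxx.
Qed.

(** In the induction step the new maximum, when it is not fixed, is classified
on either side unless it takes the first place; the always true relation shows
that this happens on both sides simultaneously. *)
Lemma word_perm_bijection n :
  exists Phi : 'S_n.+1 -> 'S_n.+1, injective Phi /\
    forall s gt eq lt,
      word_stat (by_order gt eq lt) (Phi s) = perm_stat (by_order gt eq lt) s.
Proof.
elim: n => [|n [Phi [Phi_inj Phi_stat]]].
  exists id; split=> // s gt eq lt; apply/setP => v.
  by rewrite in_word_stat0 ?ord1 // inE ord1.
have [dec insK decK] := cycle_ins_bij n.+1.
pose Psi (sx : 'S_n.+1 * 'I_n.+2) := word_ins (Phi sx.1) (slot (Phi sx.1) sx.2).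
exists (Psi \o dec); split.
  apply: inj_comp (can_inj decK) => -[s x] [t y] /(@word_ins_inj n.+1 (_, _) (_, _)).
  by case=> /Phi_inj -> /perm_inj ->.
move=> s gt eq lt; rewrite -[in RHS](decK s) /Psi /=; case: (dec s) => {}s x /=.
apply/setP => v; case: (unliftP ord_max v) => [y|] ->.
  by rewrite slot_cycle_old cycle_ins_old Phi_stat.
case: (unliftP ord_max x) => [y|] ->; last first.
  by rewrite slot_max_fixed cycle_ins_fixed.
rewrite slot_max_exc cycle_ins_exc.
by rewrite -in_word_stat_true Phi_stat in_perm_stat_true.
Qed.

(** * The six statistics *)

(** Distinct positions carry distinct letters, so the two relations need only
agree off the diagonal. *)
Lemma word_statE n (R R' : rel nat) (w : 'S_n) :
    (forall a b, a != b -> R' a b = R a.+1 b) ->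
  [set w j | j : 'I_n & [exists i : 'I_n, (j == i.+1 :> nat) && R' (w i) (w j)]]
    = word_stat R w.
Proof.
move=> eqR; apply/setP => v; rewrite inE -[in LHS](permKV w v).
rewrite mem_imset ?inE; last exact: perm_inj.
apply: eq_existsb => i; rewrite permKV; case: eqP => //= Ei.
rewrite eqR //; apply/eqP => /val_inj Ev; move: Ei; rewrite -Ev permK; lia.
Qed.

Lemma perm_statE n (R R' : rel nat) (s : 'S_n) :
    (forall a b, R' a b = R a b) ->
  [set s i | i : 'I_n & (0 < i) && R' i (s i)] = perm_stat R s.
Proof.
move=> eqR; apply/setP => v; rewrite inE -[in LHS](permKV s v).
by rewrite mem_imset ?inE ?permKV ?eqR //; apply: perm_inj.
Qed.

Theorem theorem4 (n : nat) (hn : 0 < n) :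
  exists Phi : 'S_n -> 'S_n,
    bijective Phi /\
    forall pi : 'S_n,
      (Asc2 (Phi pi), Des (Phi pi), Suc (Phi pi)) =
      (Exc_hat pi, Drop pi, Fix_hat pi).
Proof.
case: n hn => // n _; have [Phi [Phi_inj Phi_stat]] := word_perm_bijection n.
exists Phi; split=> [|s]; first exact: injF_bij.
have transport gt eq lt (Rw Rp : rel nat) :
    (forall a b, a != b -> Rw a b = by_order gt eq lt a.+1 b) ->
    (forall a b, Rp a b = by_order gt eq lt a b) ->
  [set Phi s j | j : 'I_n.+1 &
    [exists i : 'I_n.+1, (j == i.+1 :> nat) && Rw (Phi s i) (Phi s j)]]
    = [set s i | i : 'I_n.+1 & (0 < i) && Rp i (s i)].
  by move=> /word_statE-> /perm_statE->.
congr (_, _, _).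
- apply: (transport false false true (fun a b => a + 2 <= b) (fun a b => a < b)).
    by move=> a b; rewrite /by_order; do 2?case: ifP; lia.
  by move=> a b; rewrite /by_order; do 2?case: ifP; lia.
- apply: (transport true false false (fun a b => b < a) (fun a b => b < a)).
    by move=> a b; rewrite /by_order; do 2?case: ifP; lia.
  by move=> a b; rewrite /by_order; do 2?case: ifP; lia.
- apply: (transport false true false (fun a b => b == a + 1) (fun a b => b == a)).
    by move=> a b; rewrite /by_order; do 2?case: ifP; lia.
  by move=> a b; rewrite /by_order; do 2?case: ifP; lia.
Qed.
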